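(* Let $m\in\mathbb{N}^{*}$, let $(X,d)$ be a complete metric space, and let $\mathcal{F}=((X,d),(f_i)_{i\in I})$ be a generalized possibly infinite iterated function system of order $m$. Suppose that at least one of the following conditions is satisfied: (i) there exists a comparison function $\varphi$ such that all the functions $f_i$, $i\in I$, are $\varphi$-contractions; (ii) the family of functions $(f_i)_{i\in I}$ is uniformly Meir-Keeler; (iii) $I$ is finite and all the functions $f_i$, $i\in I$, are Meir-Keeler. Let $\pi_0\in\mathcal{C}$ be the unique element of $\mathcal{C}$ such that $H_{\mathcal{F}}(\pi_0,\dots,\pi_0)=\pi_0$ and $\lim_{n\to\infty}H_{\mathcal{F}}^{[n]}(f,\dots,f)=\pi_0$ for every $f\in\mathcal{C}$, and let $A_{\mathcal{F}}$ be the attractor of $\mathcal{F}$. Then $\overline{\pi_0(\Omega)}=A_{\mathcal{F}}$.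
   Context: $\mathbb{N}^{*}=\{1,2,\dots\}$. The sets $X$ and $I$ are nonempty. For a metric space $(Y,\rho)$ and $m\in\mathbb{N}^*$, $Y^m$ carries the maximum metric $\rho_{\max}((x_1,\dots,x_m),(y_1,\dots,y_m))=\max_j \rho(x_j,y_j)$; for $(X,d)$ it is written $d_{\max}$. A generalized possibly infinite iterated function system of order $m$ is a pair $\mathcal{F}=((X,d),(f_i)_{i\in I})$, where $(X,d)$ is a metric space, each $f_i:X^m\to X$ is continuous, and the family $(f_i)_{i\in I}$ is bounded, i.e. $\bigcup_{i\in I}f_i(B)$ is bounded for every bounded $B\subseteq X^m$. Attractor: let $\mathcal{B}(X)$ be the set of nonempty closed bounded subsets of $X$ and $\mathcal{K}(X)$ the set of nonempty compact subsets of $X$. The fractal operator $\mathcal{F}_{\mathcal{F}}:\mathcal{B}(X)^m\to\mathcal{B}(X)$ is $\mathcal{F}_{\mathcal{F}}(B_1,\dots,B_m)=\overline{\bigcup_{i\in I}f_i(B_1\times\dots\times B_m)}$. The attractor $A_{\mathcal{F}}$ is the unique $A\in\mathcal{B}(X)$ with $\mathcal{F}_{\mathcal{F}}(A,\dots,A)=A$; if $I$ is finite, the convention is that $\mathcal{F}_{\mathcal{F}}$ is regarded as a map $\mathcal{K}(X)^m\to\mathcal{K}(X)$ and $A_{\mathcal{F}}$ is the unique $A\in\mathcal{K}(X)$ with $\mathcal{F}_{\mathcal{F}}(A,\dots,A)=A$. Code space: $\Omega_1=I$, $\Omega_{k+1}=\Omega_k\times\dots\times\Omega_k$ ($m$ times),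 and $\Omega=\Omega_1\times\Omega_2\times\cdots$. Elements of $\Omega$ are written $\alpha=\alpha^1\alpha^2\dots\alpha^k\dots$ with $\alpha^k\in\Omega_k$; for $k\ge2$ write $\alpha^k=\alpha^k_1\alpha^k_2\dots\alpha^k_m$ with $\alpha^k_i\in\Omega_{k-1}$, and for $i\in\{1,\dots,m\}$ put $\alpha(i)=\alpha^2_i\alpha^3_i\alpha^4_i\dots\in\Omega$. $\Omega$ is endowed with the metric $d(\alpha,\beta)=\sum_{k\ge1}c^k\,\delta(\alpha^k,\beta^k)$, where $c\in(0,1)$ is fixed and $\delta(\alpha^k,\beta^k)$ is $1$ if $\alpha^k\neq\beta^k$ and $0$ otherwise. $\mathcal{C}$ is the set of continuous bounded functions $f:\Omega\to X$ with the metric $d_u(f,g)=\sup_{\alpha\in\Omega}d(f(\alpha),g(\alpha))$. The operator $H_{\mathcal{F}}:\mathcal{C}^m\to\mathcal{C}$ is $H_{\mathcal{F}}(g_1,\dots,g_m)(\alpha)=f_{\alpha^1}(g_1(\alpha(1)),\dots,g_m(\alpha(m)))$ for $\alpha=\alpha^1\alpha^2\dots\in\Omega$. For a set $Y$ and $f:Y^m\to Y$, the functions $f^{[k]}:Y^{m^k}\to Y$ are defined by $f^{[1]}=f$ and $f^{[k+1]}(x_1,\dots,x_m)=f(f^{[k]}(x_1),\dots,f^{[k]}(x_m))$ for $(x_1,\dots,x_m)\in Y^{m^k}\times\dots\times Y^{m^k}=Y^{m^{k+1}}$. A comparison function is a map $\varphi:[0,\infty)\to[0,\infty)$ that is nondecreasing,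 right-continuous, and satisfies $\varphi(t)<t$ for all $t>0$. A map $f:X^m\to X$ is a $\varphi$-contraction if $d(f(x),f(y))\le\varphi(d_{\max}(x,y))$ for all $x,y\in X^m$. It is Meir-Keeler if for every $\varepsilon>0$ there is $\delta_\varepsilon>0$ such that $d(f(x),f(y))<\varepsilon$ for all $x,y\in X^m$ with $d_{\max}(x,y)<\varepsilon+\delta_\varepsilon$. A family $(f_i)_{i\in I}$ of maps $X^m\to X$ is uniformly Meir-Keeler if for every $\varepsilon>0$ there are $\delta_\varepsilon,\lambda_\varepsilon>0$ such that $d(f_i(x),f_i(y))<\varepsilon-\lambda_\varepsilon$ for all $i\in I$ and all $x,y\in X^m$ with $d_{\max}(x,y)<\varepsilon+\delta_\varepsilon$. Under the hypotheses of the claim, the element $\pi_0$ and the attractor $A_{\mathcal{F}}$ exist. *)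

(* Defs.v *)
From HB Require Import structures.
From mathcomp Require Import all_boot all_order all_algebra.
From mathcomp Require Import all_classical all_reals all_analysis.

Set Implicit Arguments.
Unset Strict Implicit.
Unset Printing Implicit Defensive.

Import Order.TTheory GRing.Theory Num.Theory.
Import numFieldNormedType.Exports.

Local Open Scope classical_set_scope.
Local Open Scope ring_scope.

(* Like every [completeType], these spaces are pointed, hence nonempty. *)
#[short(type="completeMetricType")]
HB.structure Definition CompleteMetric (K : numDomainType) :=
  {T of CompletePseudoMetric K T & Metric K T}.

Definition metric_bounded {R : realType} {Y : metricType R} (B : set Y) : Prop :=
  exists M : R, forall x y, B x -> B y -> mdist x y <= M.

(* [Y^m] with the maximum metric. Distances being nonnegative, the default value
   0 of the iterated maximum only matters for m = 0. *)
Definition power (m : nat) (Y : Type) : Type := 'I_m -> Y.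

Section PowerMetric.
Context {R : realType} (m : nat) (Y : metricType R).
Implicit Types x y z : power m Y.

Definition dmax x y : R := \big[Num.max/0]_(j < m) mdist (x j) (y j).

Let dmax_ge0 x y : 0 <= dmax x y.
Proof. exact: bigmax_ge_id. Qed.

Let dmax_le x y j : mdist (x j) (y j) <= dmax x y.
Proof. exact: le_bigmax. Qed.

Let dmaxxx x : dmax x x = 0.
Proof.
apply/eqP; rewrite eq_le dmax_ge0 andbT.
by apply: bigmax_le => // j _; rewrite metric_structure.mdistxx.
Qed.

Let dmax_positivity x y : dmax x y = 0 -> x = y.
Proof.
move=> xy0; apply/funext => j; apply: mdist_positivity; apply/eqP.
by rewrite eq_le mdist_ge0 andbT -xy0 dmax_le.
Qed.

Let dmax_sym x y : dmax x y = dmax y x.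
Proof. by apply: eq_bigr => j _; rewrite metric_sym. Qed.

Let dmax_triangle y x z : dmax x z <= dmax x y + dmax y z.
Proof.
apply: bigmax_le => [|j _]; first exact: addr_ge0.
by rewrite (le_trans (metric_triangle _ (y j) _))// lerD.
Qed.

HB.instance Definition _ := gen_eqMixin (power m Y).
HB.instance Definition _ := gen_choiceMixin (power m Y).
HB.instance Definition _ := isMetric.Build R (power m Y)
  dmaxxx dmax_positivity dmax_sym dmax_triangle.

End PowerMetric.

(* [iter_power m k Y] is [Y^(m^k)], with [Y^(m^(k+1))] identified with
   [(Y^(m^k))^m]. *)
Fixpoint iter_power (m k : nat) (Y : Type) : Type :=
  if k is k'.+1 then power m (iter_power m k' Y) else Y.

(* [iterate f k] is [f^[k]]; by convention [f^[0]] is the identity, so that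
   [f^[1] = f]. *)
Fixpoint iterate (m : nat) (Y : Type) (f : power m Y -> Y) (k : nat) :
    iter_power m k Y -> Y :=
  match k with
  | 0 => id
  | k'.+1 => fun x => f (fun j => iterate f (x j))
  end.

Fixpoint diagonal_point (m k : nat) (Y : Type) (y : Y) : iter_power m k Y :=
  match k with
  | 0 => y
  | k'.+1 => fun _ => diagonal_point m k' y
  end.

(* [level m I k] is [Omega_(k+1)]. *)
Fixpoint level (m : nat) (I : Type) (k : nat) : Type :=
  if k is k'.+1 then power m (level m I k') else I.

(* The code space; the coordinate [alpha k] is [alpha^(k+1)]. The constant c of
   the metric is a parameter of the type, so that the metric can be attached
   to it. *)
Definition codes {R : realType} {c : R} (c01 : 0 < c < 1) (m : nat) (I : Type)
  : Type := forall k, level m I k.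

Section CodeMetric.
Context {R : realType} {c : R} (c01 : 0 < c < 1) (m : nat) (I : Type).
Implicit Types alpha beta gamma : codes c01 m I.

Definition discr {T : Type} (x y : T) : R := (~~ `[< x = y >])%:R.

Definition code_term alpha beta : R^nat :=
  fun k => c ^+ k.+1 * discr (alpha k) (beta k).

Definition code_dist alpha beta : R := limn (series (code_term alpha beta)).

Let c_gt0 : 0 < c. Proof. by case/andP: c01. Qed.
Let c_lt1 : c < 1. Proof. by case/andP: c01. Qed.

Lemma code_term_ge0 alpha beta k : 0 <= code_term alpha beta k.
Proof. by rewrite mulr_ge0 ?exprn_ge0 ?ler0n// ltW. Qed.

Lemma is_cvg_code_series alpha beta : cvgn (series (code_term alpha beta)).
Proof.
apply: (@series_le_cvg _ _ (geometric c c)).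
- exact: code_term_ge0.
- by move=> k; rewrite /geometric/= mulr_ge0 ?exprn_ge0 ?ltW.
- move=> k; rewrite /geometric/= -exprS ler_piMr ?exprn_ge0 ?(ltW c_gt0)//.
  by rewrite /discr; case: (`[< _ >]); rewrite ?ler01.
- by apply: is_cvg_geometric_series; rewrite ger0_norm ?ltW.
Qed.

Lemma code_series_le alpha beta n :
  series (code_term alpha beta) n <= code_dist alpha beta.
Proof.
apply: nondecreasing_cvgn_le; last exact: is_cvg_code_series.
by apply: nondecreasing_series => k _ _; exact: code_term_ge0.
Qed.

Lemma code_dist_le alpha beta M :
  (forall n, series (code_term alpha beta) n <= M) -> code_dist alpha beta <= M.
Proof.
move=> leM; apply: limr_le; first exact: is_cvg_code_series.
by apply: nearW => n; exact: leM.
Qed.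

Lemma code_term_le alpha beta k : code_term alpha beta k <= code_dist alpha beta.
Proof.
apply: le_trans (code_series_le alpha beta k.+1).
rewrite /series/= big_nat_recr//= lerDr sumr_ge0// => i _.
exact: code_term_ge0.
Qed.

Lemma code_dist_ge0 alpha beta : 0 <= code_dist alpha beta.
Proof. exact: le_trans (code_term_ge0 _ _ 0%N) (code_term_le _ _ 0%N). Qed.

Let code_distxx alpha : code_dist alpha alpha = 0.
Proof.
apply/eqP; rewrite eq_le code_dist_ge0 andbT.
apply: code_dist_le => n; rewrite /series/= big1// => k _.
by rewrite /code_term /discr asboolT// mulr0.
Qed.

Lemma code_dist_lt alpha beta k :
  code_dist alpha beta < c ^+ k.+1 -> alpha k = beta k.
Proof.
move=> lt_c; apply: contrapT => neq.
have := le_lt_trans (code_term_le alpha beta k) lt_c.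
by rewrite /code_term /discr asboolF//= mulr1 ltxx.
Qed.

Let code_positivity alpha beta : code_dist alpha beta = 0 -> alpha = beta.
Proof.
move=> d0; apply: functional_extensionality_dep => k.
by apply: code_dist_lt; rewrite d0 exprn_gt0.
Qed.

Let code_sym alpha beta : code_dist alpha beta = code_dist beta alpha.
Proof.
rewrite /code_dist; congr (limn (series _)); apply/funext => k.
rewrite /code_term /discr; congr (_ * (~~ _)%:R).
by apply/asbool_equiv_eq; split=> ->.
Qed.

Let code_triangle beta alpha gamma :
  code_dist alpha gamma <= code_dist alpha beta + code_dist beta gamma.
Proof.
apply: code_dist_le => n.
apply: le_trans (lerD (code_series_le _ _ n) (code_series_le _ _ n)).
rewrite /series/= -big_split/=; apply: ler_sum => k _.
rewrite /code_term -mulrDr ler_wpM2l ?exprn_ge0 ?(ltW c_gt0)// /discr.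
case: (asboolP (alpha k = beta k)) => [->|_]; first by rewrite /= add0r.
by rewrite /= -natrD ler_nat; case: (~~ _).
Qed.

HB.instance Definition _ := gen_eqMixin (codes c01 m I).
HB.instance Definition _ := gen_choiceMixin (codes c01 m I).
HB.instance Definition _ := isMetric.Build R (codes c01 m I)
  code_distxx code_positivity code_sym code_triangle.

(* [branch alpha j] is [alpha(j)]. *)
Definition branch alpha (j : 'I_m) : codes c01 m I := fun k => alpha k.+1 j.

Lemma code_dist_branch alpha beta j :
  c * code_dist (branch alpha j) (branch beta j) <= code_dist alpha beta.
Proof.
rewrite mulrC -ler_pdivlMr//; apply: code_dist_le => n; rewrite ler_pdivlMr//.
apply: le_trans (code_series_le alpha beta n.+1).
rewrite /series/= big_nat_recl// big_distrl/=.
rewrite -[leLHS]add0r lerD ?code_term_ge0//; apply: ler_sum => k _.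
rewrite /code_term [leLHS]mulrC mulrA -exprS.
rewrite ler_wpM2l ?exprn_ge0 ?(ltW c_gt0)// /discr /branch.
by case: (asboolP (alpha k.+1 = _)) => [->|_]; [rewrite asboolT|rewrite lern1 leq_b1].
Qed.

End CodeMetric.

(* The continuous bounded functions from S to X, with the metric of uniform
   convergence. *)
Record bcfun {R : realType} (S X : metricType R) := BCFun {
  bcfun_val :> S -> X;
  bcfun_continuous : continuous bcfun_val;
  bcfun_bounded : metric_bounded (range bcfun_val) }.

Section UniformMetric.
Context {R : realType} (S X : metricType R).
Implicit Types f g h : bcfun S X.

Lemma bcfun_ext f g : f =1 g -> f = g.
Proof.
case: f g => [f cf bf] [g cg bg] /= /funext fg; subst g.
by congr BCFun; exact: Prop_irrelevance.
Qed.

Definition du f g : R := sup [set mdist (f s) (g s) | s in [set: S]].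

Lemma du_has_ubound f g : has_ubound [set mdist (f s) (g s) | s in [set: S]].
Proof.
have [M fM] := bcfun_bounded f; have [N gN] := bcfun_bounded g.
have [[s0 _]|S0] := pselect ([set: S] !=set0); last first.
  by exists 0 => _ [s _ <-]; absurd: S0; exists s.
exists (M + (mdist (f s0) (g s0) + N)) => _ [s _ <-].
apply: le_trans (metric_triangle _ (f s0) _) _.
apply: lerD; first by apply: fM; [exists s|exists s0].
apply: le_trans (metric_triangle _ (g s0) _) _.
by rewrite lerD2l; apply: gN; [exists s0|exists s].
Qed.

Lemma mdist_le_du f g s : mdist (f s) (g s) <= du f g.
Proof. by apply: ub_le_sup; [exact: du_has_ubound|exists s]. Qed.

Lemma du_le f g M :
  0 <= M -> (forall s, mdist (f s) (g s) <= M) -> du f g <= M.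
Proof.
move=> M0 fgM; have [E0|/set0P E0] :=
  eqVneq [set mdist (f s) (g s) | s in [set: S]] set0.
  by rewrite /du E0 sup0.
by apply: ge_sup => // _ [s _ <-].
Qed.

Let du_ge0 f g : 0 <= du f g.
Proof.
have [E0|/set0P[_ [s _ _]]] :=
  eqVneq [set mdist (f s) (g s) | s in [set: S]] set0.
  by rewrite /du E0 sup0.
exact: le_trans (mdist_ge0 _ _) (mdist_le_du f g s).
Qed.

Let duxx f : du f f = 0.
Proof.
apply/eqP; rewrite eq_le du_ge0 andbT.
by apply: du_le => // s; rewrite metric_structure.mdistxx.
Qed.

Let du_positivity f g : du f g = 0 -> f = g.
Proof.
move=> fg0; apply: bcfun_ext => s; apply: mdist_positivity; apply/eqP.
by rewrite eq_le mdist_ge0 andbT -fg0 mdist_le_du.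
Qed.

Let du_sym f g : du f g = du g f.
Proof.
by rewrite /du; congr sup; apply: eq_imagel => s _; rewrite metric_sym.
Qed.

Let du_triangle g f h : du f h <= du f g + du g h.
Proof.
apply: du_le => [|s]; first exact: addr_ge0.
by rewrite (le_trans (metric_triangle _ (g s) _))// lerD ?mdist_le_du.
Qed.

HB.instance Definition _ := gen_eqMixin (bcfun S X).
HB.instance Definition _ := gen_choiceMixin (bcfun S X).
HB.instance Definition _ := isMetric.Build R (bcfun S X)
  duxx du_positivity du_sym du_triangle.

End UniformMetric.

(* Generalized possibly infinite iterated function systems of order m. *)
Record gifs {R : realType} (m : nat) (X : metricType R) (I : Type) := Gifs {
  gifs_fun :> I -> power m X -> X;
  gifs_continuous : forall i, continuous (gifs_fun i);
  gifs_bounded : forall B : set (power m X), metric_bounded B ->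
    metric_bounded (\bigcup_i (gifs_fun i @` B)) }.

Section Attractor.
Context {R : realType} {m : nat} {X : metricType R} {I : Type}.
Variable F : gifs m X I.

Definition closed_bounded_sets : set (set X) :=
  [set B | B !=set0 /\ closed B /\ metric_bounded B].

Definition compact_sets : set (set X) := [set B | B !=set0 /\ compact B].

Definition fractal_operator (B : power m (set X)) : set X :=
  closure (\bigcup_i (F i @` [set x | forall j, B j (x j)])).

(* Where fixed points are sought: K(X) for a finite index set, B(X) otherwise. *)
Definition fractal_space : set (set X) :=
  if `[< finite_set [set: I] >] then compact_sets else closed_bounded_sets.

Definition is_attractor : set X -> Prop :=
  unique (fun A => fractal_space A /\ fractal_operator (fun _ => A) = A).

End Attractor.

Section CodeOperator.
Context {R : realType} {c : R} (c01 : 0 < c < 1).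
Context {m : nat} {X : metricType R} {I : Type}.
Variable F : gifs m X I.

Local Notation Omega := (codes c01 m I).

Definition code_map (g : power m (bcfun Omega X)) (alpha : Omega) : X :=
  F (alpha 0%N) (fun j => g j (branch alpha j)).

Lemma continuous_code_map g : continuous (code_map g).
Proof.
have c0 : 0 < c by case/andP: c01.
move=> alpha.
apply/(@metricType_numDomainType.cvgrPdist_lt _ _ _ _ (nbhs_filter alpha)).
move=> e e0.
have := @gifs_continuous _ _ _ _ F (alpha 0%N) (fun j => g j (branch alpha j)).
move=> /metricType_numDomainType.cvgrPdist_lt/(_ _ e0).
move=> /metricType_numDomainType.nbhs_mdistP[d /= d0 Fd].
have g_near : \forall beta \near alpha, forall j : 'I_m,
    mdist (g j (branch alpha j)) (g j (branch beta j)) < d.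
  apply: (@filter_forall _ _ _ _ (nbhs_filter alpha)) => j.
  have := @bcfun_continuous _ _ _ (g j) (branch alpha j).
  move=> /metricType_numDomainType.cvgrPdist_lt/(_ _ d0).
  move=> /(@metricType_numDomainType.nbhs_mdistP _ Omega)[r /= r0 gr].
  apply/(@metricType_numDomainType.nbhs_mdistP _ Omega); exists (c * r) => /=.
    exact: mulr_gt0.
  move=> beta /= ab; apply: gr => /=; rewrite -(ltr_pM2l c0).
  exact: le_lt_trans (code_dist_branch _ _ _) ab.
have alpha0 : \forall beta \near alpha, alpha 0%N = (beta : Omega) 0%N.
  apply/(@metricType_numDomainType.nbhs_mdistP _ Omega); exists (c ^+ 1) => /=.
    by rewrite expr1.
  by move=> beta; exact: code_dist_lt.
near=> beta; rewrite /code_map.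
have <- : alpha 0%N = beta 0%N by near: beta.
apply: Fd => /=; apply/bigmax_ltP; split=> // j _.
by move: j; near: beta.
Unshelve. all: by end_near. Qed.

Lemma bounded_code_map g : metric_bounded (range (code_map g)).
Proof.
pose B := [set x : power m X | forall j, range (g j) (x j)].
have bB : metric_bounded B.
  have /choice[M gM] : forall j, exists M : R, forall x y,
    range (g j) x -> range (g j) y -> mdist x y <= M.
    by move=> j; exact: bcfun_bounded (g j).
  exists (\big[Num.max/0]_(j < m) M j) => x y Bx By.
  apply: bigmax_le => [|j _]; first exact: bigmax_ge_id.
  exact: le_trans (gM j _ _ (Bx j) (By j)) (le_bigmax _ _ _).
have [M FM] := gifs_bounded F bB.
have FB alpha : (\bigcup_i (F i @` B)) (code_map g alpha).
  exists (alpha 0%N) => //; exists (fun j => g j (branch alpha j)) => //.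
by exists M => x y [alpha _ <-] [beta _ <-]; apply: FM; exact: FB.
Qed.

Definition code_operator (g : power m (bcfun Omega X)) : bcfun Omega X :=
  BCFun (@continuous_code_map g) (bounded_code_map g).

Definition is_canonical_projection : bcfun Omega X -> Prop :=
  unique (fun p => code_operator (fun _ => p) = p /\
    forall f : bcfun Omega X,
      iterate code_operator (diagonal_point m n f) @[n --> \oo] --> p).

End CodeOperator.

Section Contractions.
Context {R : realType}.

(* The map [0, +oo[ -> [0, +oo[ is given by the restriction of phi : R -> R. *)
Definition comparison_function (phi : R -> R) : Prop :=
  [/\ forall t, 0 <= t -> 0 <= phi t,
      forall s t, 0 <= s -> s <= t -> phi s <= phi t,
      forall t, 0 <= t -> phi x @[x --> t^'+] --> phi t
    & forall t, 0 < t -> phi t < t].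

Context {m : nat} {X : metricType R}.

Definition phi_contraction (phi : R -> R) (f : power m X -> X) : Prop :=
  forall x y, mdist (f x) (f y) <= phi (mdist x y).

Definition meir_keeler (f : power m X -> X) : Prop :=
  forall eps : R, 0 < eps -> exists2 delta : R, 0 < delta &
    forall x y, mdist x y < eps + delta -> mdist (f x) (f y) < eps.

Definition uniformly_meir_keeler {I : Type} (f : I -> power m X -> X) : Prop :=
  forall eps : R, 0 < eps -> exists delta lambda : R,
    [/\ 0 < delta, 0 < lambda & forall i x y,
      mdist x y < eps + delta -> mdist (f i x) (f i y) < eps - lambda].

End Contractions.

(* Main.v *)
Require Import Defs.
From mathcomp Require Import all_boot all_order all_algebra.
From mathcomp Require Import all_classical all_reals all_analysis.

Import Order.TTheory GRing.Theory Num.Theory.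
Import numFieldNormedType.Exports.

Local Open Scope classical_set_scope.
Local Open Scope ring_scope.

(** Let P be the image of the canonical projection. Every choice of a first
    letter i and of m codes beta_1, ..., beta_m comes from a code alpha with
    alpha^1 = i and alpha(j) = beta_j; hence the equation H(p, ..., p) = p says
    exactly that P is the union of the f_i(P^m) ([range_code_fixpoint]). As the
    f_i are continuous, the fractal operator takes the same value at B and at
    the closure of B ([fractal_operator_closure]), so the closure of P is a
    fixed point of it, and the attractor is its unique fixed point in the
    fractal space.

    It remains to see that the closure of P lies in the fractal space. It is
    nonempty, closed and bounded, which suffices when I is infinite. When I is
    finite it must be compact, and here the convergence of the iterates
    supplies the argument: starting from a constant function with value in A,
    all iterates take values in A since f_i(A^m) is included in A, hence so does
    their limit ([closure_range_projection_sub]). Thus the closure of P is a closed subset of the compact set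
    A. *)

Section MetricClosure.
Context {R : realType} {Y : metricType R}.
Implicit Types (B : set Y) (x : Y).

Lemma closure_mdistP B x :
  closure B x <-> forall e : R, 0 < e -> exists2 y, B y & mdist x y < e.
Proof.
split=> [clBx e e0|Bx V].
  have [|y [By xye]] := clBx [set y | mdist x y < e].
    by apply/metricType_numDomainType.nbhs_mdistP; exists e.
  by exists y.
move=> /metricType_numDomainType.nbhs_mdistP[e /= e0 eV].
by have [y By xye] := Bx e e0; exists y; split=> //; exact: eV.
Qed.

Lemma metric_bounded_closure B : metric_bounded B -> metric_bounded (closure B).
Proof.
move=> [M BM]; exists M => x y /closure_mdistP clx /closure_mdistP cly.
apply/ler_addgt0Pr => e e0; have e20 : 0 < e / 2 by rewrite divr_gt0.
have [x' Bx' xx'] := clx _ e20; have [y' By' yy'] := cly _ e20.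
rewrite (le_trans (metric_triangle _ x' _))// [in leRHS](splitr e) addrCA.
rewrite lerD ?(ltW xx')// (le_trans (metric_triangle _ y' _))//.
by rewrite lerD ?BM// metric_sym ltW.
Qed.

End MetricClosure.

Section FractalOperator.
Context {R : realType} {m : nat} {X : metricType R} {I : Type}.
Variable F : gifs m X I.

(** The closure of a power B^m is the power of the closure, so by continuity
    the points of f_i((closure B)^m) are limits of points of f_i(B^m). *)
Lemma fractal_operator_closure (B : set X) :
  fractal_operator F (fun=> closure B) = fractal_operator F (fun=> B).
Proof.
rewrite /fractal_operator; apply/seteqP; split; last first.
  apply: closureS => _ [i _ [x Bx <-]]; exists i => //; exists x => //= j.
  exact: subset_closure.
rewrite [X in _ `<=` X](closure_id _).1; last exact: closed_closure.
apply: closureS => _ [i _ [x clBx <-]] U.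
move=> /(@gifs_continuous _ _ _ _ F i x).
move=> /metricType_numDomainType.nbhs_mdistP[d /= d0 dU].
have /choice[p Bp] : forall j, exists y, B y /\ mdist (x j) y < d.
  move=> j; have /closure_mdistP/(_ _ d0)[y By xyd] := clBx j.
  by exists y.
exists (F i p); split; first by exists i => //; exists p => // j; case: (Bp j).
by apply: dU => /=; apply/bigmax_ltP; split=> // j _; case: (Bp j).
Qed.

Lemma fractal_operator_stable (A : set X) i (x : power m X) :
  fractal_operator F (fun=> A) = A -> (forall j, A (x j)) -> A (F i x).
Proof.
by move=> FA Ax; rewrite -FA; apply: subset_closure; exists i => //; exists x.
Qed.

Lemma closed_fractal_fixpoint {A : set X} :
  fractal_operator F (fun=> A) = A -> closed A.
Proof. by move=> <-; exact: closed_closure. Qed.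

Lemma fractal_space_nonempty {A : set X} : @fractal_space R X I A -> A !=set0.
Proof. by rewrite /fractal_space; case: ifP => _ []. Qed.

End FractalOperator.

Section CodeOperator.
Context {R : realType} {c : R} {c01 : 0 < c < 1}.
Context {m : nat} {X : metricType R} {I : Type}.
Variable F : gifs m X I.
Local Notation Omega := (codes c01 m I).
Implicit Types (p f : bcfun Omega X) (A : set X).

Definition code_cons (i : I) (b : 'I_m -> Omega) : Omega :=
  fun k => match k with 0 => i | k'.+1 => fun j => b j k' end.

Lemma codes_nonempty : [set: I] !=set0 -> [set: Omega] !=set0.
Proof.
move=> [i _]; suff a k : level m I k by exists a.
by elim: k => [|k a]; [exact: i|exact: (fun=> a)].
Qed.

(** Prefixing a letter to m codes ([code_cons]) inverts the splitting of a code
    into its first letter and its branches, so as alpha runs over all codes,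
    the arguments of the f_i on the right of the fixed-point equation run over
    all of P^m, where P is the range of p, independently of i. *)
Lemma range_code_fixpoint p : code_operator F (fun=> p) = p ->
  range p = \bigcup_i (F i @` [set x | forall j, range p (x j)]).
Proof.
move=> pE; have pF a : p a = F (a 0%N) (fun j => p (branch a j)).
  by rewrite -[in LHS]pE.
apply/seteqP; split=> [_ [a _ <-]|_ [i _ [x px <-]]].
  by rewrite pF; exists (a 0%N) => //; exists (fun j => p (branch a j)).
have /choice[b bx] : forall j, exists a, p a = x j.
  by move=> j; have [a _ pa] := px j; exists a.
exists (code_cons i b) => //; rewrite pF /=; congr (F i _).
by apply/funext => j; rewrite -bx.
Qed.

Lemma closure_range_fractal_fixpoint p : code_operator F (fun=> p) = p ->
  fractal_operator F (fun=> closure (range p)) = closure (range p).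
Proof.
by move=> /range_code_fixpoint pE; rewrite fractal_operator_closure [in RHS]pE.
Qed.

Lemma iterate_code_operator_stable A f n :
  (forall i (x : power m X), (forall j, A (x j)) -> A (F i x)) ->
  (forall a, A (f a)) ->
  forall a, A (iterate (code_operator F) (diagonal_point m n f) a).
Proof.
by move=> FA Af; elim: n => [|n IH] a //=; apply: FA => j; exact: IH.
Qed.

Lemma cvg_bcfun_closure A (u : nat -> bcfun Omega X) p :
  u n @[n --> \oo] --> p -> (forall n a, A (u n a)) ->
  range p `<=` closure A.
Proof.
move=> /metricType_numDomainType.cvgrPdist_lt up Au _ [a _ <-].
apply/closure_mdistP => e e0; have [N _ /(_ N (leqnn N)) pN] := up _ e0.
by exists (u N a) => //; apply: le_lt_trans pN; exact: mdist_le_du.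
Qed.

Lemma continuous_cst_bcfun (x : X) : continuous (fun _ : Omega => x).
Proof. by move=> a; apply: cvg_cst; exact: nbhs_filter. Qed.

Lemma metric_bounded_cst (x : X) : metric_bounded (range (fun _ : Omega => x)).
Proof.
by exists 0 => _ _ [a _ <-] [b _ <-]; rewrite metric_structure.mdistxx.
Qed.

Definition cst_bcfun (x : X) : bcfun Omega X :=
  BCFun (continuous_cst_bcfun x) (metric_bounded_cst x).

(** The iterates that start from a constant with value in A converge to the
    canonical projection without ever leaving the closed set A. *)
Lemma closure_range_projection_sub A p :
  is_canonical_projection F p -> A !=set0 ->
  fractal_operator F (fun=> A) = A -> closure (range p) `<=` A.
Proof.
move=> [[_ p_lim] _] [x Ax] FA.
have closedA := closed_fractal_fixpoint F FA.
(* The limit only gives that range p lies in the closure of A; as A is closed,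
   A may be replaced by the closure of its closure. *)
rewrite [X in _ `<=` X](closure_id _).1//.
rewrite [X in _ `<=` X](closure_id _).1; last exact: closed_closure.
apply: closureS; apply: cvg_bcfun_closure (p_lim (cst_bcfun x)) _ => n.
by apply: iterate_code_operator_stable => // i y; exact: fractal_operator_stable.
Qed.

End CodeOperator.

Theorem proposition4p2 (R : realType) (m : nat) (m_gt0 : (0 < m)%N)
    (X : completeMetricType R) (I : Type) (I_neq0 : [set: I] !=set0)
    (F : gifs m X I) (c : R) (c01 : 0 < c < 1)
    (F_contractive :
      [\/ exists phi : R -> R, comparison_function phi /\
            forall i, phi_contraction phi (F i),
          uniformly_meir_keeler F
        | finite_set [set: I] /\ forall i, meir_keeler (F i)])
    (pi0 : bcfun (codes c01 m I) X)
    (pi0_proj : is_canonical_projection F pi0)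
    (A : set X) (A_attractor : is_attractor F A) :
  closure (range pi0) = A.
Proof.
have [[AI FA] A_uniq] := A_attractor.
have [[pi0E _] _] := pi0_proj.
apply/esym/A_uniq; split; last exact: closure_range_fractal_fixpoint.
have [a _] := codes_nonempty (c01 := c01) (m := m) I_neq0.
have P_neq0 : closure (range pi0) !=set0.
  by exists (pi0 a); apply: subset_closure; exists a.
have P_sub : closure (range pi0) `<=` A.
  have A_neq0 := fractal_space_nonempty AI.
  exact: (closure_range_projection_sub F A pi0).
move: AI; rewrite /fractal_space; case: ifP => _ [_ AI]; split=> //.
  exact: subclosed_compact (@closed_closure _ _) AI P_sub.
split; first exact: closed_closure.
by apply: metric_bounded_closure; exact: bcfun_bounded.
Qed.
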